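(* Let $\mathfrak g$ be a Lie algebra over $k$ with a linear basis $\{a_i\}_{i\in I}$ indexed by a well-ordered set $I$, and denote its bracket by $[xy]$. In the free associative $2$-conformal algebra $C(\{a_i\}_{i\in I},(1,1),D_1,D_2)$, the set $$S=\{\,a_i\langle 0,0\rangle a_j-\{a_j\langle 0,0\rangle a_i\}-[a_ia_j]\ \mid\ i>j,\ i,j\in I\,\}$$ is a Gröbner–Shirshov basis. Here $[a_ia_j]$ is regarded as the corresponding linear combination of the generators $a_l$, $l\in I$.
   Context: Let $k$ be a field of characteristic $0$, $n\ge 1$ (here $n=2$), $\mathbb Z_+$ the non-negative integers. For $\mathbf m,\mathbf l\in\mathbb Z_+^n$, $\mathbf m\prec\mathbf l$ means $m_i<l_i$ for all $i$; $\mathbf e_i$ is the $i$-th unit vector; $(-1)^{\mathbf s}=(-1)^{s_1+\cdots+s_n}$; $\binom{\mathbf m}{\mathbf s}=\prod_i\binom{m_i}{s_i}$; $\mathbf s!=s_1!\cdots s_n!$. An $n$-conformal algebra is a $k$-vector space $C$ with bilinear products $\langle\mathbf m\rangle$ ($\mathbf m\in\mathbb Z_+^n$) and pairwise commuting linear maps $D_1,\dots,D_n$ such that (i) for all $a,b\in C$ there is $\mathbf N(a,b)\in\mathbb Z_+^n$ with $a\langle\mathbf m\rangle b=0$ whenever $\mathbf m\not\prec\mathbf N(a,b)$; (ii) $D_i(a\langle\mathbf m\rangle b)=D_ia\langle\mathbf m\rangle b+a\langle\mathbf m\rangle D_ib$; (iii) $D_ia\langle\mathbf m\rangle b=-m_i\,a\langle\mathbf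 m-\mathbf e_i\rangle b$ (zero if $m_i=0$). It is associative if $(a\langle\mathbf m\rangle b)\langle\mathbf m'\rangle c=\sum_{\mathbf s\in\mathbb Z_+^n}(-1)^{\mathbf s}\binom{\mathbf m}{\mathbf s}a\langle\mathbf m-\mathbf s\rangle(b\langle\mathbf m'+\mathbf s\rangle c)$ for all $a,b,c,\mathbf m,\mathbf m'$ (terms with zero binomial coefficient are omitted). In it put $$\{b\langle\mathbf m\rangle a\}=\sum_{\mathbf s\in\mathbb Z_+^n}(-1)^{\mathbf m+\mathbf s}\frac{1}{\mathbf s!}D_1^{s_1}\cdots D_n^{s_n}(b\langle\mathbf m+\mathbf s\rangle a).$$ Fix $\mathbf N\in\mathbb Z_+^n$ and a non-empty well-ordered set $B$ (here $\mathbf N=(1,1)$, $B=\{a_i\}_{i\in I}$ ordered by $a_i>a_j$ iff $i>j$). $C=C(B,\mathbf N,D_1,\dots,D_n)$ is the free associative $n$-conformal algebra on $B$ with constant locality $\mathbf N$: it is generated by $B$, satisfies $a\langle\mathbf m\rangle b=0$ for $a,b\in B$, $\mathbf m\not\prec\mathbf N$, and any map $\varepsilon$ from $B$ to an associative $n$-conformal algebra with $\varepsilon(a)\langle\mathbf m\rangle\varepsilon(b)=0$ for $a,b\in B$, $\mathbf m\not\prec\mathbf N$, extends uniquely to a homomorphism. Write $D^{\mathbf i}=D_1^{i_1}\cdots D_n^{i_n}$. An associative normal word is a formal expression $u=a_1\langle\mathbf m^{(1)}\rangle a_2\langle\mathbf m^{(2)}\rangle\cdots a_r\langle\mathbf m^{(r)}\rangle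 D^{\mathbf i}a_{r+1}$ with $r\ge0$, $a_j\in B$, $\mathbf m^{(j)}\prec\mathbf N$, $\mathbf i\in\mathbb Z_+^n$; $|u|=r+1$; $u$ is D-free if $\mathbf i=\mathbf 0$; $T$ is the set of these words. $[u]$ is its right-normed bracketing $a_1\langle\mathbf m^{(1)}\rangle(a_2\langle\mathbf m^{(2)}\rangle(\cdots))$, an element of $C$ called a normal word. For $w\in T$, $wD^{\mathbf j}$ is obtained by applying $D^{\mathbf j}$ to the last letter of $w$. The normal words form a $k$-basis of $C$; elements of $C$ are called polynomials, and a polynomial is D-free if all normal words occurring in it are D-free. Words are ordered by lexicographic comparison of the weights $wt(u)=(|u|,a_1,\mathbf m^{(1)},\dots,a_r,\mathbf m^{(r)},a_{r+1},\mathbf i)$, with $B$ in its given order and $\mathbb Z_+^n$ ordered lexicographically. $\overline f$ is the largest $u$ such that $[u]$ occurs in $f\neq0$; $f$ is monic if its coefficient is $1$. For D-free $a\in T$, $b\in T$, $\mathbf m\prec\mathbf N$, $a\langle\mathbf m\rangle b$ denotes concatenation in $T$; words displayed around a polynomial or leading word may be empty (written $1$), in which case the adjacent product symbol is omitted; all product indices in words and $S$-words below are $\prec\mathbf N$. Let $S\subset C$ be a set of monic polynomials. Normal $S$-words: of the first kind, $[a\langle\mathbf m\rangle s\langle\mathbf m'\rangle b]$ with $s\in S$ D-free, $a\in T$ D-free or empty, $b\in T$ or empty; of the second kind, $[a\langle\mathbf m\rangle D^{\mathbf i}s]$ with $s\in S$, $\mathbf i\in\mathbb Z_+^n$, $a\in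 T$ D-free or empty. Here $[\cdot]$ is right-normed bracketing with $s$, resp. $D^{\mathbf i}s$, treated as one letter. Compositions, for monic $f,g$ and $w\in T$: (inclusion) if $g$ is D-free and $w=\overline f=u\langle\mathbf m\rangle\overline g\langle\mathbf m'\rangle v$ with $u$ D-free, $(f,g)_w=f-[u\langle\mathbf m\rangle g\langle\mathbf m'\rangle v]$; (right inclusion) if $w=\overline fD_{j_1}^{i_1}\cdots D_{j_l}^{i_l}=u\langle\mathbf m\rangle\overline gD_{j_{l+1}}^{i_{l+1}}\cdots D_{j_n}^{i_n}$ with $u$ D-free, $i_1,\dots,i_n\in\mathbb Z_+$ and $(j_1,\dots,j_n)$ a permutation of $(1,\dots,n)$, $(f,g)_w=D_{j_1}^{i_1}\cdots D_{j_l}^{i_l}f-[u\langle\mathbf m\rangle D_{j_{l+1}}^{i_{l+1}}\cdots D_{j_n}^{i_n}g]$; (intersection) if $f$ is D-free, $w=\overline f\langle\mathbf m\rangle v=u\langle\mathbf m'\rangle\overline g$ with $u,v\in T$, $u$ D-free, $|\overline f|+|\overline g|>|w|$, $(f,g)_w=[f\langle\mathbf m\rangle v]-[u\langle\mathbf m'\rangle g]$; (left multiplication) $a\langle\mathbf m\rangle f$ with $a\in B$, $\mathbf m\not\prec\mathbf N$; (right multiplication) $f\langle\mathbf m\rangle a$ with $f$ not D-free, $a\in B$, $\mathbf m\in\mathbb Z_+^n$. $(f,g)_w$ is trivial modulo $S$ if it is a (possibly empty) finite linear combination of normal $S$-words $[u_l\langle\mathbf m^{(l)}\rangle s_l\langle\mathbf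 m'^{(l)}\rangle v_l]$ (first kind) and $[u_j\langle\mathbf m^{(j)}\rangle D^{\mathbf i_j}s_j]$ (second kind) with $u_l\langle\mathbf m^{(l)}\rangle\overline{s_l}\langle\mathbf m'^{(l)}\rangle v_l<w$ and $u_j\langle\mathbf m^{(j)}\rangle\overline{s_j}D^{\mathbf i_j}<w$, all these $S$-words being D-free if $f$ and $g$ are both D-free. A left or right multiplication composition $h$ is trivial modulo $S$ if it is such a combination with these leading words of length $\le|\overline h|$ (instead of $<w$), all $S$-words being D-free if $h$ is a right multiplication, or a left multiplication $a\langle\mathbf m\rangle f$ with $f$ D-free. $S$ is a Gröbner–Shirshov basis if all compositions of elements of $S$ are trivial modulo $S$. *)

(* Defs.v *)
From HB Require Import structures.
From mathcomp Require Import all_boot all_order all_algebra finmap.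
From mathcomp Require Import boolp classical_sets cardinality fsbigop wochoice.

Set Implicit Arguments.
Unset Strict Implicit.
Unset Printing Implicit Defensive.
Import Order.TTheory GRing.Theory.

Local Open Scope classical_set_scope.
Local Open Scope ring_scope.

Section MultiIndices.
Variable n : nat.

Definition mi := n.-tuple nat.

Implicit Types m s l : mi.

Definition m0 : mi := [tuple 0%N | _ < n].
Definition me (i : 'I_n) : mi := [tuple nat_of_bool (j == i) | j < n].
Definition madd m s : mi := [tuple (tnth m j + tnth s j)%N | j < n].
(* Truncated; only used with a coefficient that vanishes unless s <= m. *)
Definition msub m s : mi := [tuple (tnth m j - tnth s j)%N | j < n].
Definition mlt m l : bool := [forall i, tnth m i < tnth l i]%N.
Definition mdeg m : nat := (\sum_(i < n) tnth m i)%N.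
Definition mbin m s : nat := (\prod_(i < n) 'C(tnth m i, tnth s i))%N.
Definition mfact s : nat := (\prod_(i < n) (tnth s i)`!)%N.
Definition mrestr (J : {set 'I_n}) m : mi :=
  [tuple if j \in J then tnth m j else 0%N | j < n].

End MultiIndices.

Arguments m0 {n}.

Record nconf (k : fieldType) (n : nat) := NConf {
  carrier :> lmodType k;
  cD : 'I_n -> carrier -> carrier;
  cprod : carrier -> mi n -> carrier -> carrier;
  cD_linear : forall i, linear (cD i);
  cD_comm : forall i j x, cD i (cD j x) = cD j (cD i x);
  cprod_linearl : forall m b, linear (fun a => cprod a m b);
  cprod_linearr : forall a m, linear (cprod a m);
  cprod_local : forall a b, exists N : mi n,
    forall m, ~~ mlt m N -> cprod a m b = 0;
  cD_prod : forall i a m b,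
    cD i (cprod a m b) = cprod (cD i a) m b + cprod a m (cD i b);
  cprod_D : forall i a m b,
    cprod (cD i a) m b = - ((tnth m i)%:R *: cprod a (msub m (me i)) b) }.

Arguments cD {k n C} i x : rename.
Arguments cprod {k n C} a m b : rename.

Section Conformal.
Variables (k : fieldType) (n : nat).

Definition associative_conf (C : nconf k n) : Prop :=
  forall (a b c : C) (m m' : mi n),
    cprod (cprod a m b) m' c =
    \sum_(s \in [set: mi n]) ((-1) ^+ mdeg s * (mbin m s)%:R) *:
       cprod a (msub m s) (cprod b (madd m' s) c).

Definition Dpow (C : nconf k n) (i : mi n) (x : C) : C :=
  foldr (fun (j : 'I_n) (y : C) => iter (tnth i j) (cD j) y) x (enum 'I_n).

(* {b<m>a}; the family is finitely supported by cprod_local. *)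
Definition curly (C : nconf k n) (b : C) (m : mi n) (a : C) : C :=
  \sum_(s \in [set: mi n])
    ((-1) ^+ mdeg (madd m s) * ((mfact s)%:R)^-1) *:
      Dpow s (cprod b (madd m s) a).

Definition conf_hom (C E : nconf k n) (phi : C -> E) : Prop :=
  [/\ linear phi,
      forall i x, phi (cD i x) = cD i (phi x)
    & forall a m b, phi (cprod a m b) = cprod (phi a) m (phi b)].

Definition conf_closed (C : nconf k n) (P : set C) : Prop :=
  [/\ P 0, forall (c : k) x y, P x -> P y -> P (c *: x + y),
      forall i x, P x -> P (cD i x)
    & forall a m b, P a -> P b -> P (cprod a m b)].

Definition generated_by (B : Type) (C : nconf k n) (gen : B -> C) : Prop :=
  forall P : set C, conf_closed P -> (forall b, P (gen b)) -> forall x, P x.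

Definition local_on (B : Type) (N : mi n) (C : nconf k n) (gen : B -> C) :=
  forall (a b : B) (m : mi n), ~~ mlt m N -> cprod (gen a) m (gen b) = 0.

(* C is C(B, N, D_1, ..., D_n), the generators being the gen b. *)
Definition free_assoc_conf (B : Type) (N : mi n) (C : nconf k n)
    (gen : B -> C) : Prop :=
  [/\ associative_conf C, generated_by gen, local_on N gen
    & forall (E : nconf k n) (eps : B -> E),
        associative_conf E -> local_on N eps ->
        exists phi : C -> E,
          [/\ conf_hom phi, forall b, phi (gen b) = eps b
            & forall psi : C -> E, conf_hom psi ->
                (forall b, psi (gen b) = eps b) -> forall x, psi x = phi x]].

End Conformal.

(* ((a_1, m_1) :: ... :: (a_r, m_r), (a_{r+1}, i)) stands for the word
   a_1 <m_1> a_2 <m_2> ... a_r <m_r> D^i a_{r+1}. *)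
Definition word (B : choiceType) (n : nat) : choiceType :=
  (seq (B * mi n) * (B * mi n))%type.

Section Words.
Variables (d : Order.disp_t) (B : orderType d) (n : nat).

Local Notation word := (word B n).
(* A possibly empty left factor "a <m>" with a a D-free word: it amounts to the
   list of the letters of a, each with the product index following it. *)
Local Notation left := (seq (B * mi n)).
(* A possibly empty right factor "<m> b". *)
Local Notation right := (option (mi n * word)).

Definition wpre (u : word) : left := u.1.
Definition wlast (u : word) : B := u.2.1.
Definition wexp (u : word) : mi n := u.2.2.
Definition wlen (u : word) : nat := (size (wpre u)).+1.

(* Membership in T. *)
Definition normal_left (N : mi n) (p : left) : bool := all (fun x => mlt x.2 N) p.
Definition normal_word (N : mi n) (u : word) : bool := normal_left N (wpre u).
Definition normal_right (N : mi n) (q : right) : bool :=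
  if q is Some (m, v) then mlt m N && normal_word N v else true.

Definition wDfree (u : word) : bool := wexp u == m0.

(* For equal lengths, the lexicographic order on the lists
   (a_1, m_1), ..., (a_r, m_r), (a_{r+1}, i) is that on the weights. *)
Definition wt (u : word) : nat *l seqlexi (B *l n.-tuplelexi nat) :=
  (wlen u, rcons (wpre u) (wlast u, wexp u)).
Definition wle (u v : word) : bool := (wt u <= wt v)%O.
Definition wlt (u v : word) : bool := (wt u < wt v)%O.

(* Concatenation a <m> b, for a D-free. *)
Definition wcat (a : word) (m : mi n) (b : word) : word :=
  (wpre a ++ (wlast a, m) :: wpre b, (wlast b, wexp b)).
Definition wcatl (p : left) (u : word) : word := (p ++ wpre u, u.2).
Definition wcatr (u : word) (q : right) : word :=
  if q is Some (m, v) then wcat u m v else u.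
Definition wD (u : word) (j : mi n) : word :=
  (wpre u, (wlast u, madd (wexp u) j)).

Variables (k : fieldType) (N : mi n) (C : nconf k n) (gen : B -> C).

Definition bracketl (p : left) (x : C) : C :=
  foldr (fun am y => cprod (gen am.1) am.2 y) x p.
Definition nword (u : word) : C :=
  bracketl (wpre u) (Dpow (wexp u) (gen (wlast u))).
Definition bracketr (x : C) (q : right) : C :=
  if q is Some (m, v) then cprod x m (nword v) else x.

(* c is the coefficient family of f on the normal words; it is unique when C is
   free, since the normal words then form a basis. *)
Definition expansion (f : C) (c : {fsfun word -> k with 0}) : Prop :=
  (forall u, u \in finsupp c -> normal_word N u) /\
  f = \sum_(u <- finsupp c) c u *: nword u.

(* The leading word of f is w, with coefficient al (in particular f != 0). *)
Definition leading_term (f : C) (w : word) (al : k) : Prop :=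
  exists2 c, expansion f c &
    [/\ w \in finsupp c, c w = al
      & forall v, v \in finsupp c -> wle v w].
Definition leading (f : C) (w : word) : Prop := exists al, leading_term f w al.
Definition monic_conf (f : C) : Prop := exists w, leading_term f w 1.
Definition Dfree (f : C) : Prop :=
  exists2 c, expansion f c & forall u, u \in finsupp c -> wDfree u.

(* Sword S x w : x is a normal S-word and w is the word obtained from it by
   replacing s by its leading word. *)
Inductive Sword (S : set C) : C -> word -> Prop :=
| Sword_first p s sb q :
    S s -> Dfree s -> leading s sb -> normal_left N p -> normal_right N q ->
    Sword S (bracketl p (bracketr s q)) (wcatl p (wcatr sb q))
| Sword_second p i s sb :
    S s -> leading s sb -> normal_left N p ->
    Sword S (bracketl p (Dpow i s)) (wcatl p (wD sb i)).

(* composition f g w h : h is a composition (f,g)_w. *)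
Inductive composition (f g : C) : word -> C -> Prop :=
| comp_inclusion fb gb p q :
    leading f fb -> leading g gb -> Dfree g ->
    normal_left N p -> normal_right N q ->
    fb = wcatl p (wcatr gb q) ->
    composition f g fb (f - bracketl p (bracketr g q))
| comp_right_inclusion fb gb p (J : {set 'I_n}) (i : mi n) w :
    (* J is {j_1, ..., j_l}; the D_j commute, so only this set matters. The
       exponent of D_j is tnth i j. *)
    leading f fb -> leading g gb -> normal_left N p ->
    w = wD fb (mrestr J i) -> w = wcatl p (wD gb (mrestr (~: J) i)) ->
    composition f g w
      (Dpow (mrestr J i) f - bracketl p (Dpow (mrestr (~: J) i) g))
| comp_intersection fb gb u m v m' w :
    leading f fb -> leading g gb -> Dfree f ->
    normal_word N u -> wDfree u -> normal_word N v -> mlt m N -> mlt m' N ->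
    w = wcat fb m v -> w = wcat u m' gb -> (wlen fb + wlen gb > wlen w)%N ->
    composition f g w
      (cprod f m (nword v) - bracketl (rcons (wpre u) (wlast u, m')) g).

(* h is a linear combination of normal S-words whose leading words satisfy P,
   and which are D-free if df holds. *)
Definition Scomb (S : set C) (P : word -> Prop) (df : Prop) (h : C) : Prop :=
  exists r : seq (k * C),
    (forall cx, cx \in r ->
       exists w, [/\ Sword S cx.2 w, P w & df -> Dfree cx.2]) /\
    h = \sum_(cx <- r) cx.1 *: cx.2.

Definition trivial_at (S : set C) (w : word) (df : Prop) (h : C) : Prop :=
  Scomb S (fun v => wlt v w) df h.

Definition trivial_mult (S : set C) (df : Prop) (h : C) : Prop :=
  h = 0 \/
  exists2 hb, leading h hb & Scomb S (fun v => (wlen v <= wlen hb)%N) df h.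

Definition GS_basis (S : set C) : Prop :=
  [/\ forall s, S s -> monic_conf s,
      forall f g w h, S f -> S g -> composition f g w h ->
        trivial_at S w (Dfree f /\ Dfree g) h,
      forall (a : B) m f, S f -> ~~ mlt m N ->
        trivial_mult S (Dfree f) (cprod (gen a) m f)
    & forall (a : B) m f, S f -> ~ Dfree f ->
        trivial_mult S True (cprod f m (gen a))].

End Words.

Section Lie.
Variables (k : fieldType) (g : lmodType k).

Definition lie_bracket (br : g -> g -> g) : Prop :=
  [/\ forall y, linear (fun x => br x y), forall x, linear (br x),
      forall x, br x x = 0
    & forall x y z, br x (br y z) + br y (br z x) + br z (br x y) = 0].

Definition linear_basis (I : choiceType) (a : I -> g) : Prop :=
  forall x, exists! c : {fsfun I -> k with 0},
    x = \sum_(i <- finsupp c) c i *: a i.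

End Lie.

Definition ueaS (k : fieldType) (d : Order.disp_t) (I : orderType d)
    (g : lmodType k) (br : g -> g -> g) (a : I -> g)
    (C : nconf k 2) (gen : I -> C) : set C :=
  [set f | exists (i j : I) (c : {fsfun I -> k with 0}),
     [/\ (j < i)%O, br (a i) (a j) = \sum_(l <- finsupp c) c l *: a l
       & f = cprod (gen i) [tuple 0%N; 0%N] (gen j)
             - curly (gen j) [tuple 0%N; 0%N] (gen i)
             - \sum_(l <- finsupp c) c l *: gen l]].

(* Main.v *)
(* For N = (1,1) the only admissible product index is 0, so [{b<0>a} = b<0>a],
   the product [<0>] is associative and the relations are the usual ones
   [x_i x_j - x_j x_i - [a_i a_j]], with leading word [x_i x_j].  The only overlaps
   are the words [x_i x_j x_l] with [i > j > l], resolved by the Jacobi identity as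
   in the Poincare-Birkhoff-Witt theorem, and left multiplication by [a<m>], [m] not
   0, kills the relations by associativity and locality.  Leading words are well
   defined because the normal words are linearly independent: for each normal word
   the universal property yields a map to the current conformal algebra over a
   matrix algebra, and a suitable matrix coefficient there detects that word among
   all the normal words. *)
Require Import Defs.
From HB Require Import structures.
From mathcomp Require Import all_boot all_order all_algebra finmap zify.
From mathcomp Require Import boolp classical_sets functions cardinality fsbigop wochoice.

Set Implicit Arguments.
Unset Strict Implicit.
Unset Printing Implicit Defensive.
Import Order.TTheory GRing.Theory.

Local Open Scope ring_scope.

(** * Multi-indices and alternating binomial sums *)

Section MultiIndexArithmetic.
Variable n : nat.
Implicit Types (m s t l N : mi n) (i j : 'I_n).

Lemma mi_eq m s : (forall i, tnth m i = tnth s i :> nat) -> m = s.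
Proof. exact: eq_from_tnth. Qed.

Definition mle s m : bool := [forall i, tnth s i <= tnth m i]%N.

Lemma tnth_m0 i : tnth (@m0 n) i = 0%N. Proof. by rewrite tnth_mktuple. Qed.
Lemma tnth_me i j : tnth (@me n i) j = (j == i). Proof. by rewrite tnth_mktuple. Qed.
Lemma tnth_madd m s i : tnth (madd m s) i = (tnth m i + tnth s i)%N.
Proof. by rewrite tnth_mktuple. Qed.
Lemma tnth_msub m s i : tnth (msub m s) i = (tnth m i - tnth s i)%N.
Proof. by rewrite tnth_mktuple. Qed.

Definition tnthE := (tnth_m0, tnth_me, tnth_madd, tnth_msub).

Lemma add0m m : madd m0 m = m.
Proof. by apply: mi_eq => i; rewrite !tnthE. Qed.

Lemma addm0 m : madd m m0 = m.
Proof. by apply: mi_eq => i; rewrite !tnthE addn0. Qed.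

Lemma maddC m s : madd m s = madd s m.
Proof. by apply: mi_eq => i; rewrite !tnthE addnC. Qed.

Lemma maddA m s t : madd m (madd s t) = madd (madd m s) t.
Proof. by apply: mi_eq => i; rewrite !tnthE addnA. Qed.

Lemma maddK m s : msub (madd m s) s = m.
Proof. by apply: mi_eq => i; rewrite !tnthE addnK. Qed.

Lemma msub_me_K m i : (0 < tnth m i)%N -> madd (msub m (me i)) (me i) = m.
Proof.
move=> m_gt0; apply: mi_eq => j; rewrite !tnthE.
case: eqP => [->|_]; last by rewrite subn0 addn0.
by rewrite subnK.
Qed.

Lemma madd_injl s : injective (fun m => madd m s).
Proof. by move=> m t /(congr1 (fun r => msub r s)); rewrite !maddK. Qed.

Lemma mleP s m : reflect (forall i, tnth s i <= tnth m i)%N (mle s m).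
Proof. exact: forallP. Qed.

Lemma mle_trans s m t : mle s m -> mle m t -> mle s t.
Proof. by move=> /mleP h /mleP h'; apply/mleP => i; exact: leq_trans (h i) (h' i). Qed.

Lemma mlem0 m : mle m m0 = (m == m0).
Proof.
apply/mleP/eqP => [h|-> //]; apply: mi_eq => i.
have := h i; rewrite !tnthE; lia.
Qed.

Lemma mltPn m N : reflect (exists i, tnth N i <= tnth m i)%N (~~ mlt m N).
Proof.
apply: (iffP idP) => [/forallPn [i]|[i]]; first by rewrite -leqNgt; exists i.
by rewrite leqNgt => h; apply/forallPn; exists i.
Qed.

Lemma mdeg_add m s : mdeg (madd m s) = (mdeg m + mdeg s)%N.
Proof. by rewrite /mdeg -big_split; apply: eq_bigr => i _; rewrite tnthE. Qed.

Lemma mdeg_me i : mdeg (@me n i) = 1%N.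
Proof.
rewrite /mdeg (bigD1 i) //= tnthE eqxx big1 // => j /negbTE ji.
by rewrite tnthE ji.
Qed.

Lemma mdeg0 : mdeg (@m0 n) = 0%N.
Proof. by rewrite /mdeg big1 // => i _; rewrite tnthE. Qed.

(** Induction on the total degree: a multi-index of positive degree has a positive coordinate, from
    which a unit vector can be removed. *)
Lemma mi_ind (P : mi n -> Prop) :
  P m0 -> (forall m i, P m -> P (madd m (me i))) -> forall m, P m.
Proof.
move=> P0 PS m; move: {2}(mdeg m) (erefl (mdeg m)) => q; elim: q m => [|q IH] m.
  move/eqP; rewrite sum_nat_eq0 => /forallP h.
  suff -> : m = m0 by [].
  by apply: mi_eq => i; rewrite tnthE; apply/eqP/h.
case: (pickP (fun i => 0 < tnth m i)%N) => [i m_gt0|m0P] mq; last first.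
  move: mq; rewrite /mdeg big1 // => i _.
  by have := m0P i; rewrite lt0n => /negbFE/eqP.
rewrite -(msub_me_K m_gt0); apply/PS/IH.
by move: mq; rewrite -{1}(msub_me_K m_gt0) mdeg_add mdeg_me addn1 => -[].
Qed.

Lemma mbin_gt m s : ~~ mle s m -> mbin m s = 0%N.
Proof.
move=> /forallPn [i]; rewrite -ltnNge => lt_ms.
by rewrite /mbin (bigD1 i) //= bin_small.
Qed.

Lemma mbinm0 m : mbin m m0 = 1%N.
Proof. by rewrite /mbin big1 // => i _; rewrite tnthE bin0. Qed.

Lemma mbin_pascal m s i :
  mbin (madd m (me i)) (madd s (me i)) = (mbin m (madd s (me i)) + mbin m s)%N.
Proof.
rewrite /mbin (bigD1 i) //= [X in (X + _)%N](bigD1 i) //= [X in (_ + X)%N](bigD1 i) //=.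
rewrite !tnthE eqxx !addn1 binS mulnDl; congr (_ * _ + _ * _)%N.
all: by apply: eq_bigr => j /negbTE ji; rewrite !tnthE ji ?addn0.
Qed.

Lemma mbin_pascal0 m s i : tnth s i = 0%N -> mbin (madd m (me i)) s = mbin m s.
Proof.
move=> si; apply: eq_bigr => j _; rewrite !tnthE.
by case: eqP => [->|_]; rewrite ?addn0 // si !bin0.
Qed.

Lemma mbin_diag m s i :
  (mbin (madd m (me i)) (madd s (me i)) * (tnth s i).+1 =
   (tnth m i).+1 * mbin m s)%N.
Proof.
rewrite /mbin (bigD1 i) //= [X in (_ = _ * X)%N](bigD1 i) //= !tnthE eqxx !addn1.
rewrite mulnAC (mulnC 'C(_, _)) -mul_bin_diag mulnA; congr (_ * _)%N.
by apply: eq_bigr => j /negbTE ji; rewrite !tnthE ji !addn0.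
Qed.

Lemma mbin_down m s i :
  (mbin m s * (tnth m i - tnth s i) = tnth m i * mbin (msub m (me i)) s)%N.
Proof.
rewrite /mbin (bigD1 i) //= [X in (_ = _ * X)%N](bigD1 i) //= !tnthE eqxx subn1.
rewrite mulnAC (mulnC 'C(_, _)) -mul_bin_down mulnA; congr (_ * _)%N.
by apply: eq_bigr => j /negbTE ji; rewrite !tnthE ji !subn0.
Qed.

Lemma finite_mle m : finite_set [set s | mle s m]%classic.
Proof.
pose F (f : {ffun 'I_n -> 'I_(mdeg m).+1}) : mi n := [tuple nat_of_ord (f i) | i < n].
apply: (@sub_finite_set _ _ (F @` setT)%classic); last first.
  exact: finite_image.
move=> s /= /mleP le_sm.
have lt_s i : (tnth s i < (mdeg m).+1)%N.
  by rewrite ltnS (leq_trans (le_sm i)) // /mdeg (bigD1 i) //= leq_addr.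
exists [ffun i => Ordinal (lt_s i)] => //.
by apply: mi_eq => i; rewrite tnth_mktuple ffunE.
Qed.

(** As a finite set, the box carries ordinary big sums; it contains every [s] with [mbin m s]
    nonzero. *)
Definition mbox m : {fset mi n} := fset_set [set s | mle s m]%classic.

Lemma in_mbox m s : (s \in mbox m) = mle s m.
Proof.
rewrite in_fset_set; last exact: finite_mle.
by apply/idP/idP; rewrite inE.
Qed.

End MultiIndexArithmetic.

(** * Sums weighted by signed binomial coefficients *)

Section BinomialSums.
Variables (k : fieldType) (V : lmodType k) (n : nat).
Implicit Types (m s t K : mi n) (i : 'I_n) (F G : mi n -> V).

Definition bcoef m s : k := (-1) ^+ mdeg s * (mbin m s)%:R.
(** If [F s] is read as the monomial [x^(m-s) y^s], this is the expansion of [(x - y)^m]. The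
    identities below are facts about such powers. *)
Definition bsum m F : V := \sum_(s <- mbox m) bcoef m s *: F s.

Lemma bcoef_gt m s : ~~ mle s m -> bcoef m s = 0.
Proof. by move=> h; rewrite /bcoef mbin_gt // mulr0. Qed.

Lemma fsbig_bcoef m F :
  \sum_(s \in [set: mi n]) bcoef m s *: F s = bsum m F.
Proof.
rewrite -(@fsbig_widen _ _ _ _ [set s | mle s m]%classic) //; last first.
  by move=> s [_ /= /negP h]; rewrite /= bcoef_gt ?scale0r.
by rewrite fsbig_finite //; exact: finite_mle.
Qed.

(** The added coefficients vanish, so sums with different [m] can be compared term by term over one
    common box. *)
Lemma bsum_widen m K F : mle m K ->
  bsum m F = \sum_(s <- mbox K) bcoef m s *: F s.
Proof.
move=> mK; rewrite [RHS](bigID (fun s => mle s m)) /= [X in _ + X]big1 ?addr0; last first.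
  by move=> s h; rewrite bcoef_gt ?scale0r.
rewrite -big_filter; apply: perm_big; apply: uniq_perm => //.
  by rewrite filter_uniq.
move=> s; rewrite mem_filter !in_mbox.
by case: (boolP (mle s m)) => // h; rewrite (mle_trans h).
Qed.

Lemma eq_bsum m F G : (forall s, mle s m -> F s = G s) -> bsum m F = bsum m G.
Proof.
by move=> FG; apply: eq_big_seq => s; rewrite in_mbox => h; rewrite FG.
Qed.

Lemma bsum0 m : bsum m (fun=> 0) = 0.
Proof. by apply: big1 => s _; rewrite scaler0. Qed.

Lemma bsumD m F G : bsum m (fun s => F s + G s) = bsum m F + bsum m G.
Proof. by rewrite /bsum -big_split; apply: eq_bigr => s _; rewrite scalerDr. Qed.

Lemma bsumZ m c F : bsum m (fun s => c *: F s) = c *: bsum m F.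
Proof.
by rewrite scaler_sumr; apply: eq_bigr => s _; rewrite !scalerA mulrC.
Qed.

Lemma bsumN m F : bsum m (fun s => - F s) = - bsum m F.
Proof. by rewrite -sumrN; apply: eq_bigr => s _; rewrite scalerN. Qed.

Lemma bsumB m F G : bsum m (fun s => F s - G s) = bsum m F - bsum m G.
Proof. by rewrite bsumD bsumN. Qed.

Lemma bsum_m0 F : bsum m0 F = F m0.
Proof.
rewrite /bsum; have -> : mbox (@m0 n) = [fset m0]%fset.
  by apply/fsetP => s; rewrite in_mbox mlem0 inE.
by rewrite big_seq_fset1 /bcoef mdeg0 mbinm0 mulr1 scale1r.
Qed.

Lemma mbox_shift K i G :
  \sum_(s <- mbox (madd K (me i)) | (0 < tnth s i)%N) G s =
  \sum_(s <- mbox K) G (madd s (me i)).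
Proof.
rewrite -big_filter -(big_map (fun s => madd s (me i)) predT G).
apply: perm_big; apply: uniq_perm; first by rewrite filter_uniq.
  rewrite map_inj_uniq; [exact: fset_uniq | exact: madd_injl].
move=> s; rewrite mem_filter in_mbox; apply/andP/mapP => [[s_gt0 /mleP le_s]|[t]].
  exists (msub s (me i)); last by rewrite msub_me_K.
  rewrite in_mbox; apply/mleP => j; have := le_s j; rewrite !tnthE; lia.
rewrite in_mbox => /mleP le_t ->; rewrite !tnthE eqxx addn1; split=> //.
by apply/mleP => j; rewrite !tnthE leq_add2r.
Qed.

Lemma bcoef_pascal m s i :
  bcoef (madd m (me i)) (madd s (me i)) = bcoef m (madd s (me i)) - bcoef m s.
Proof.
rewrite /bcoef mbin_pascal natrD mulrDr mdeg_add mdeg_me addn1 exprS.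
by rewrite !mulN1r !mulNr.
Qed.

Lemma bcoef_diag m s i :
  bcoef (madd m (me i)) (madd s (me i)) * (tnth s i).+1%:R =
  - ((tnth m i).+1%:R * bcoef m s).
Proof.
rewrite /bcoef -mulrA -natrM mbin_diag natrM mdeg_add mdeg_me addn1 exprS mulN1r.
by rewrite mulNr mulrCA.
Qed.

Lemma bcoef_down m s i :
  bcoef m s * (tnth m i - tnth s i)%N%:R = (tnth m i)%:R * bcoef (msub m (me i)) s.
Proof. by rewrite /bcoef -mulrA -natrM mbin_down natrM mulrCA. Qed.

(** This is [(x - y)^(m + e_i) = (x_i - y_i) (x - y)^m], with [F] taking the exponents of [x] and
    [y] separately. Pascal's rule handles the terms with [s_i > 0]; for [s_i = 0] the two binomials
    agree. *)
Lemma bsumS m i (F : mi n -> mi n -> V) :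
  bsum (madd m (me i)) (fun s => F (msub (madd m (me i)) s) s) =
  bsum m (fun s => F (madd (msub m s) (me i)) s) -
  bsum m (fun s => F (msub m s) (madd s (me i))).
Proof.
have le_m : mle m (madd m (me i)) by apply/mleP => j; rewrite !tnthE leq_addr.
rewrite [X in _ = X - _](bsum_widen _ le_m) /bsum.
rewrite (bigID (fun s => 0 < tnth s i)%N) [X in _ = X - _](bigID (fun s => 0 < tnth s i)%N) /=.
rewrite !mbox_shift addrAC; congr (_ + _).
  rewrite -sumrB; apply: eq_bigr => s _.
  rewrite bcoef_pascal scalerBl; congr (_ - _ *: F _ _); last first.
    by apply: mi_eq => j; rewrite !tnthE; lia.
  (* Outside the box the truncated subtractions disagree, but there the coefficient is zero. *)
  case: (boolP (mle (madd s (me i)) m)) => [/mleP h|/bcoef_gt ->]; last first.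
    by rewrite !scale0r.
  congr (_ *: F _ _); apply: mi_eq => j.
  by have := h j; rewrite !tnthE; lia.
apply: eq_bigr => s; rewrite -eqn0Ngt => /eqP s0.
rewrite {1}/bcoef mbin_pascal0 // -/(bcoef m s).
case: (boolP (mle s m)) => [/mleP h|/bcoef_gt ->]; last by rewrite !scale0r.
congr (_ *: F _ _); apply: mi_eq => j.
by have := h j; rewrite !tnthE; lia.
Qed.

End BinomialSums.

Section BinomialSumIdentities.
Variables (k : fieldType) (V : lmodType k) (n : nat).
Implicit Types (m s t K : mi n) (i : 'I_n) (F G : mi n -> V).

(** The effect of [y_i d/dy_i] on [(x - y)^m], namely [- m_i y_i (x - y)^(m - e_i)]. *)
Lemma bsum_diag m i F :
  bsum m (fun s => (tnth s i)%:R *: F s) =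
  - ((tnth m i)%:R *: bsum (msub m (me i)) (fun s => F (madd s (me i)))).
Proof.
case: (posnP (tnth m i)) => [mi0|mi_gt0].
  rewrite mi0 scale0r oppr0 -(bsum0 V m); apply: eq_bsum => s /mleP /(_ i).
  by rewrite mi0 leqn0 => /eqP ->; rewrite scale0r.
set m' := msub m (me i); rewrite -[m](msub_me_K mi_gt0) -/m'.
rewrite {1}/bsum (bigID (fun s => 0 < tnth s i)%N) /= mbox_shift.
rewrite [X in _ + X]big1 ?addr0; last first.
  by move=> s; rewrite -eqn0Ngt => /eqP ->; rewrite scale0r scaler0.
rewrite scaler_sumr -sumrN; apply: eq_bigr => s _.
rewrite scalerA !tnth_madd !tnth_me eqxx !addn1 bcoef_diag.
by rewrite scaleNr scalerA.
Qed.

(** The effect of [d/dx_i] on [(x - y)^m], namely [m_i (x - y)^(m - e_i)]. *)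
Lemma bsum_down m i F :
  bsum m (fun s => (tnth m i - tnth s i)%N%:R *: F s) =
  (tnth m i)%:R *: bsum (msub m (me i)) F.
Proof.
have le_m : mle (msub m (me i)) m by apply/mleP => j; rewrite !tnthE leq_subr.
rewrite (bsum_widen _ le_m) scaler_sumr; apply: eq_bigr => s _.
by rewrite !scalerA bcoef_down.
Qed.

(* With [X x y z] read as the monomial [x y z], this is the expansion of
   [(x - y)^m (y - z)^m' z^l] with [x - y = (x - z) - (y - z)]. *)
Lemma bsum_assoc m m' l (X : mi n -> mi n -> mi n -> V) :
  bsum m' (fun u => bsum m (fun s =>
    X (msub m s) (madd (msub m' u) s) (madd l u))) =
  bsum m (fun s => bsum (msub m s) (fun t => bsum (madd m' s) (fun r =>
    X (msub (msub m s) t) (msub (madd m' s) r) (madd (madd l t) r)))).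
Proof.
(* [P p q] is the expansion of [(x - z)^p (y - z)^q z^l]. Raising [p] or [q] by [e_i] multiplies it
   by [x_i - z_i] or [y_i - z_i]. *)
pose P p q Y := bsum p (fun t => bsum q (fun r =>
  Y (msub p t) (msub q r) (madd (madd l t) r))) : V.
have PSl i p q Y : P (madd p (me i)) q Y =
    P p q (fun x => Y (madd x (me i))) - P p q (fun x y z => Y x y (madd z (me i))).
  rewrite /P (bsumS p i (fun x t => bsum q (fun r =>
    Y x (msub q r) (madd (madd l t) r)))).
  congr (_ - _); apply: eq_bsum => t _; apply: eq_bsum => r _.
  by rewrite -!maddA (maddC (me i) r).
have PSr i p q Y : P p (madd q (me i)) Y =
    P p q (fun x y => Y x (madd y (me i))) - P p q (fun x y z => Y x y (madd z (me i))).
  rewrite /P -bsumB; apply: eq_bsum => t _.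
  rewrite (bsumS q i (fun y r => Y (msub p t) y (madd (madd l t) r))).
  by congr (_ - _); apply: eq_bsum => r _; rewrite maddA.
have sub00 : msub m0 m0 = m0 :> mi n by apply: mi_eq => j; rewrite !tnthE.
elim/mi_ind: m m' X => [|m i IH] m' X.
  rewrite !bsum_m0 sub00 bsum_m0 !addm0; apply: eq_bsum => u _.
  by rewrite bsum_m0 sub00 addm0.
transitivity (bsum m' (fun u =>
    bsum m (fun s => X (madd (msub m s) (me i)) (madd (msub m' u) s) (madd l u)) -
    bsum m (fun s => X (msub m s) (madd (madd (msub m' u) s) (me i)) (madd l u)))).
  apply: eq_bsum => u _.
  rewrite (bsumS m i (fun x s => X x (madd (msub m' u) s) (madd l u))).
  by congr (_ - _); apply: eq_bsum => s _; rewrite maddA.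
(* The left side has been multiplied by [x_i - y_i]. On the right this factor appears as
   [(x_i - z_i) - (y_i - z_i)], and the two [z_i] terms cancel. *)
rewrite bsumB (IH m' (fun x => X (madd x (me i)))) (IH m' (fun x y => X x (madd y (me i)))).
rewrite (bsumS m i (fun x s => P x (madd m' s) X)) -!bsumB.
apply: eq_bsum => s _.
by rewrite maddA PSl PSr opprB addrA subrK.
Qed.

End BinomialSumIdentities.

(** * The current conformal algebra *)

(* The current algebra over [A]: an element is the family of its coefficients
   [f m], the [m]-th one being the coefficient of [D^m] up to the factor
   [(-1)^m m!]; equivalently, the linear functional on [k[t_1, ..., t_n]] sending
   [t^m] to [f m], so that [D_i] is minus the transpose of [d/dt_i]. *)
Section Current.
Variables (k : fieldType) (n : nat) (A : algType k).

(** The support lies in a box; the bound is phrased as in the locality axiom, so both are handled in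
    the same way. *)
Definition boundedly_supported : {pred mi n -> A} :=
  fun f => `[< exists N, forall m, ~~ mlt m N -> f m = 0 >].

Lemma boundedly_supported_submod : GRing.submod_closed boundedly_supported.
Proof.
split=> [|c f g /asboolP [N fN] /asboolP [N' gN']].
  by apply/asboolP; exists m0.
apply/asboolP; exists (madd N N') => m /mltPn [i le_m].
rewrite !fctE fN ?gN' ?scaler0 ?addr0 //; apply/mltPn; exists i.
all: by apply: leq_trans le_m; rewrite tnthE ?leq_addr ?leq_addl.
Qed.

HB.instance Definition _ :=
  GRing.isSubmodClosed.Build _ _ boundedly_supported boundedly_supported_submod.

Record current := Current {
  current_fun :> mi n -> A; current_bounded : current_fun \in boundedly_supported }.

HB.instance Definition _ := [isSub for current_fun].
HB.instance Definition _ := [Choice of current by <:].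
HB.instance Definition _ := [SubChoice_isSubLmodule of current by <:].

Implicit Types (f g h : current) (m s l : mi n) (i : 'I_n).

Lemma current_eq f g : (forall m, f m = g m) -> f = g.
Proof. by move=> fg; apply/val_inj/funext. Qed.

Lemma currentD f g m : (f + g) m = f m + g m. Proof. by []. Qed.
Lemma currentN f m : (- f) m = - f m. Proof. by []. Qed.
Lemma currentZ c f m : (c *: f) m = c *: f m. Proof. by []. Qed.
Lemma current0 m : (0 : current) m = 0. Proof. by []. Qed.

Definition currentE := (currentD, currentN, currentZ, current0).

Lemma current_supp f : exists N, forall m, ~~ mlt m N -> f m = 0.
Proof. exact/asboolP/(current_bounded f). Qed.

Lemma current_bsumE m (F : mi n -> current) l :
  bsum m F l = bsum m (fun s => F s l).
Proof. by rewrite /bsum -[LHS]/(val _ l) raddf_sum /= fct_sumE. Qed.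

Fact curD_bounded i f :
  (fun m => - ((tnth m i)%:R *: f (msub m (me i)))) \in boundedly_supported.
Proof.
have [N fN] := current_supp f; apply/asboolP; exists (madd N (me i)).
move=> m /mltPn [j le_m]; rewrite fN ?scaler0 ?oppr0 //; apply/mltPn; exists j.
by move: le_m; rewrite !tnthE; lia.
Qed.
Definition curD i f := Current (curD_bounded i f).

Lemma curDE i f m : curD i f m = - ((tnth m i)%:R *: f (msub m (me i))).
Proof. by []. Qed.

Fact curM_bounded f m g :
  (fun l => bsum m (fun s => f (msub m s) * g (madd l s))) \in boundedly_supported.
Proof.
have [N gN] := current_supp g; apply/asboolP; exists N => l /mltPn [j le_l].
rewrite -(bsum0 A m); apply: eq_bsum => s _.
rewrite gN ?mulr0 //; apply/mltPn; exists j.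
by rewrite tnthE; lia.
Qed.
(** For [f] and [g] seen as functionals, the value at [t^l] is that of [f] tensor [g] on
    [(x - y)^m y^l]. *)
Definition curM f m g := Current (curM_bounded f m g).

Lemma curME f m g l : curM f m g l = bsum m (fun s => f (msub m s) * g (madd l s)).
Proof. by []. Qed.

Fact curD_linear i : linear (curD i).
Proof.
move=> c f g; apply: current_eq => m; rewrite !(currentE, curDE).
by rewrite scalerDr opprD scalerN !scalerA mulrC.
Qed.

Fact curD_comm i j f : curD i (curD j f) = curD j (curD i f).
Proof.
have [-> //|/negbTE ij] := eqVneq i j.
apply: current_eq => m; rewrite !curDE !tnth_msub !tnth_me ij eq_sym ij !subn0.
rewrite !scalerN !opprK !scalerA mulrC; congr (_ *: f _).
by apply: mi_eq => q; rewrite !tnthE subnAC.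
Qed.

Fact curM_linearl m g : linear (fun f => curM f m g).
Proof.
move=> c f h; apply: current_eq => l; rewrite !(currentE, curME) -bsumZ -bsumD.
by apply: eq_bsum => s _; rewrite !currentE mulrDl scalerAl.
Qed.

Fact curM_linearr f m : linear (curM f m).
Proof.
move=> c g h; apply: current_eq => l; rewrite !(currentE, curME) -bsumZ -bsumD.
by apply: eq_bsum => s _; rewrite !currentE mulrDr scalerAr.
Qed.

(** If [m_i] is at least [N_i + N'_i], then each [s] in the box has [s_i] at least [N'_i], which
    kills the factor [g], or [m_i - s_i] at least [N_i], which kills [f]. *)
Fact curM_local f g : exists N, forall m, ~~ mlt m N -> curM f m g = 0.
Proof.
have [[N fN] [N' gN']] := (current_supp f, current_supp g).
exists (madd N N') => m /mltPn [i]; rewrite tnthE => le_m.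
apply: current_eq => l; rewrite curME current0 -(bsum0 A m).
apply: eq_bsum => s /mleP /(_ i) le_s.
have [lt_s|ge_s] := ltnP (tnth s i) (tnth N' i).
  by rewrite fN ?mul0r //; apply/mltPn; exists i; rewrite tnthE; lia.
by rewrite gN' ?mulr0 //; apply/mltPn; exists i; rewrite tnthE; lia.
Qed.

Fact curM_D i f m g :
  curM (curD i f) m g = - ((tnth m i)%:R *: curM f (msub m (me i)) g).
Proof.
apply: current_eq => l; rewrite !(currentE, curME).
rewrite -bsum_down -bsumN; apply: eq_bsum => s _.
rewrite curDE tnth_msub mulNr scalerAl; congr (- ((_ *: f _) * _)).
by apply: mi_eq => j; rewrite !tnthE subnAC.
Qed.

(** The operator [d/dx_i + d/dy_i] kills [x - y], so on [(x - y)^m y^l] it only differentiates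
    [y^l]. *)
Fact curD_prod i f m g :
  curD i (curM f m g) = curM (curD i f) m g + curM f m (curD i g).
Proof.
rewrite curM_D; apply: current_eq => l; rewrite !(currentE, curDE, curME).
transitivity (bsum m (fun s =>
    - ((tnth l i)%:R *: (f (msub m s) * g (madd (msub l (me i)) s))))).
  by rewrite bsumN bsumZ.
pose F s := f (msub m s) * g (msub (madd l s) (me i)).
have -> : bsum (msub m (me i)) (fun s => f (msub (msub m (me i)) s) * g (madd l s)) =
    bsum (msub m (me i)) (fun s => F (madd s (me i))).
  apply: eq_bsum => s _; rewrite /F maddA maddK; congr (f _ * _).
  by apply: mi_eq => j; rewrite !tnthE; lia.
(* The term differentiating [f] becomes a sum weighted by [s_i], which cancels the [s_i] part of the
   weight [l_i + s_i] coming from [g]. *)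
rewrite -bsum_diag -bsumD; apply: eq_bsum => s _.
rewrite curDE tnth_madd mulrN -scalerAr natrD scalerDl opprD addrCA subrr addr0.
have [l0|l_gt0] := posnP (tnth l i); first by rewrite l0 !scale0r.
rewrite /F; congr (- (_ *: (_ * g _))); apply: mi_eq => j; rewrite !tnthE.
by case: eqP => [->|]; lia.
Qed.

(** Both sides evaluate [f] tensor [g] tensor [h] on [(x - y)^m (y - z)^m' z^l]; [bsum_assoc]
    compares the two expansions. *)
Lemma curM_assoc f g h m m' :
  curM (curM f m g) m' h =
  \sum_(s \in [set: mi n]) ((-1) ^+ mdeg s * (mbin m s)%:R) *:
     curM f (msub m s) (curM g (madd m' s) h).
Proof.
rewrite (fsbig_bcoef m (fun s => curM f (msub m s) (curM g (madd m' s) h))).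
apply: current_eq => l; rewrite current_bsumE curME.
transitivity (bsum m' (fun u => bsum m (fun s =>
  f (msub m s) * g (madd (msub m' u) s) * h (madd l u)))).
  apply: eq_bsum => u _; rewrite curME mulr_suml; apply: eq_bigr => s _.
  by rewrite -!scalerAl.
apply: (etrans (bsum_assoc m m' l (fun x y z => f x * g y * h z))).
apply: eq_bsum => s _; rewrite curME; apply: eq_bsum => t _.
rewrite curME mulr_sumr; apply: eq_bigr => r _.
by rewrite -scalerAr mulrA.
Qed.

Definition cur : nconf k n :=
  NConf curD_linear curD_comm curM_linearl curM_linearr curM_local curD_prod curM_D.

Lemma cur_assoc : associative_conf cur.
Proof. by move=> f g h m m'; exact: curM_assoc. Qed.

End Current.

(** * Linear maps given as bare functions *)

Section LinearMaps.
Variables (k : fieldType) (U V : lmodType k) (f : U -> V).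
Hypothesis f_linear : linear f.

Let fL : {linear U -> V} := HB.pack f (GRing.isLinear.Build k U V _ f f_linear).

Lemma lin0 : f 0 = 0. Proof. exact: (linear0 fL). Qed.
Lemma linN x : f (- x) = - f x. Proof. exact: (linearN fL). Qed.
Lemma linD x y : f (x + y) = f x + f y. Proof. exact: (linearD fL). Qed.
Lemma linB x y : f (x - y) = f x - f y. Proof. exact: (linearB fL). Qed.
Lemma linZ c x : f (c *: x) = c *: f x. Proof. exact: (linearZZ fL). Qed.
Lemma lin_sum (T : Type) (r : seq T) (P : pred T) (F : T -> U) :
  f (\sum_(x <- r | P x) F x) = \sum_(x <- r | P x) f (F x).
Proof. exact: (linear_sum fL). Qed.

End LinearMaps.

(** * Linear independence of the normal words *)

Section CurrentDelta.
Variables (k : fieldType) (n : nat) (A : algType k).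
Implicit Types (m e l : mi n) (x y : A) (i : 'I_n).

Fact cdelta_bounded e x :
  (fun m => if m == e then x else 0) \in @boundedly_supported k n A.
Proof.
apply/asboolP; exists [tuple (tnth e i).+1 | i < n] => m /mltPn [i].
by rewrite tnth_mktuple; case: eqP => [->|//]; rewrite ltnn.
Qed.
(** In characteristic 0 this is [D^e] of the constant current [x], up to a nonzero scalar. *)
Definition cdelta e x : cur n A := Current (cdelta_bounded e x).

Lemma cdeltaE e x m : cdelta e x m = if m == e then x else 0.
Proof. by []. Qed.

Lemma curD_delta i e x :
  cD i (cdelta e x) = cdelta (madd e (me i)) (- ((tnth e i).+1%:R *: x)).
Proof.
apply: current_eq => m; rewrite [LHS]curDE !cdeltaE.
have [->|ne] := eqVneq m (madd e (me i)).
  by rewrite maddK eqxx tnth_madd tnth_me eqxx addn1.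
have [m0|m_gt0] := posnP (tnth m i); first by rewrite m0 scale0r oppr0.
case: eqP => [me_e|_]; last by rewrite scaler0 oppr0.
by move: ne; rewrite -me_e msub_me_K // eqxx.
Qed.

Lemma curM_delta x e y : cprod (cdelta m0 x) m0 (cdelta e y) = cdelta e (x * y).
Proof.
apply: current_eq => l; rewrite [LHS]curME bsum_m0 addm0 !cdeltaE.
rewrite (_ : msub m0 m0 = m0 :> mi n); last by apply: mi_eq => i; rewrite !tnthE.
by rewrite eqxx; case: ifP => _; rewrite ?mulr0.
Qed.

(** A surviving term would need [s = m] from the first factor and [l + s = 0] from the second, hence
    [m = 0]. Constant currents thus satisfy the locality required of the generators. *)
Lemma curM_delta0 x m y : m != m0 -> cprod (cdelta m0 x) m (cdelta m0 y) = 0.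
Proof.
move=> nz_m; apply: current_eq => l; rewrite [LHS]curME current0.
rewrite -(bsum0 A m); apply: eq_bsum => s /mleP le_s; rewrite !cdeltaE.
case: eqP => [ms|_]; last by rewrite mul0r.
case: eqP => [ls|_]; last by rewrite mulr0.
case/eqP: nz_m; apply: mi_eq => i.
move: (congr1 (fun t => tnth t i) ms) (congr1 (fun t => tnth t i) ls) (le_s i).
rewrite !tnthE; lia.
Qed.

Hypothesis char0 : [pchar k] =i pred0.

(** Each [D_i] raises the exponent by [e_i] and multiplies by minus a positive integer, which is
    invertible in characteristic 0. *)
Lemma Dpow_delta e :
  exists2 c : k, c != 0 & forall x, Dpow e (cdelta m0 x) = cdelta e (c *: x).
Proof.
have natr_neq0 q : q.+1%:R != 0 :> k by move/pcharf0P: char0 => ->.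
(* [tgt] repeats the recursion of [Dpow], so an induction on the list of indices can follow the
   exponent reached so far. *)
pose tgt (r : seq 'I_n) : mi n :=
  foldr (fun j t => iter (tnth e j) (fun t' => madd t' (me j)) t) m0 r.
have tgtE : tgt (enum 'I_n) = e.
  apply: mi_eq => i.
  transitivity (\sum_(j <- enum 'I_n) tnth e j * (i == j))%N; last first.
    rewrite big_enum /= (bigD1 i) //= eqxx muln1 big1 ?addn0 // => j ji.
    by rewrite eq_sym (negbTE ji) muln0.
  elim: (enum 'I_n) => [|j r IH] /=; first by rewrite big_nil tnthE.
  rewrite big_cons -IH; elim: (tnth e j) => [|q IHq] //=.
  by rewrite tnth_madd IHq tnth_me mulSn; lia.
rewrite -[in cdelta e]tgtE /Dpow /tgt.
elim: (enum 'I_n) => [|j r [c c_nz IH]] /=.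
  by exists 1; [exact: oner_neq0 | move=> x; rewrite scale1r].
set t := foldr _ m0 r in IH *.
suff [c' c'_nz Hc'] : exists2 c' : k, c' != 0 & forall x,
    iter (tnth e j) (cD j) (cdelta t x) =
    cdelta (iter (tnth e j) (fun t' => madd t' (me j)) t) (c' *: x).
  exists (c' * c); first by rewrite mulf_neq0.
  by move=> x; rewrite IH Hc' scalerA.
elim: (tnth e j) => [|q [c' c'_nz Hc']] /=.
  by exists 1; [exact: oner_neq0 | move=> x; rewrite scale1r].
set t' := iter q _ t in Hc' *.
exists (- ((tnth t' j).+1%:R * c')); first by rewrite oppr_eq0 mulf_neq0.
by move=> x; rewrite Hc'; apply: (etrans (curD_delta _ _ _)); rewrite scalerA scaleNr.
Qed.

End CurrentDelta.

(* The arrow from [p] to [p + 1] is labelled by the [p]-th letter of [ws], so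
   that a product of such matrices records the labels of a path. *)
Section PathMatrices.
Variables (k : fieldType) (B : eqType) (ws : seq B).
Local Notation L := (size ws).

Definition pathmx (b : B) : 'M[k]_L.+1 :=
  \matrix_(p, q) ((q == p.+1 :> nat) && (onth ws p == Some b))%:R.

Lemma prod_pathmx (bs : seq B) p q :
  (\prod_(b <- bs) pathmx b) p q =
  ((q == p + size bs :> nat)%N && (bs == take (size bs) (drop p ws)))%:R.
Proof.
elim: bs p => [|b bs IH] p.
  by rewrite big_nil mxE /= addn0 take0 eqxx andbT eq_sym.
rewrite big_cons mxE; have [lt_p|ge_p] := ltnP p L.
  have lt_p1 : (p.+1 < L.+1)%N by [].
  rewrite (bigD1 (Ordinal lt_p1)) //= [X in _ + X]big1 ?addr0; last first.
    by move=> r /negbTE; rewrite -val_eqE /= mxE => ->; rewrite mul0r.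
  rewrite mxE eqxx IH -natrM mulnb /= (drop_nth b lt_p) /= eqseq_cons addSnnS.
  rewrite onthE (nth_map b) // [in LHS]andbCA.
  by rewrite (eq_sym b).
(* No arrow leaves the last vertex, and no letter of [ws] remains to be read there. *)
rewrite [LHS]big1 => [|r _]; first by rewrite drop_oversize // andbF.
by rewrite mxE onthE nth_default ?size_map // andbF mul0r.
Qed.

End PathMatrices.

Section NormalWordsIndependent.
Variables (k : fieldType) (n : nat) (d : Order.disp_t) (B : orderType d).
Variables (N : mi n) (C : nconf k n) (gen : B -> C).
Hypotheses (char0 : [pchar k] =i pred0) (hC : free_assoc_conf N gen).
Hypothesis hN : forall m, mlt m N = (m == m0).

Lemma Dpow_hom (E : nconf k n) (phi : C -> E) e x :
  conf_hom phi -> phi (Dpow e x) = Dpow e (phi x).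
Proof.
case=> _ phiD _; rewrite /Dpow; elim: (enum 'I_n) => [|j r IH] //=.
by rewrite -IH; elim: (tnth e j) => [|q IHq] //=; rewrite phiD IHq.
Qed.

Definition letters (u : word B n) : seq B := rcons (map fst (wpre u)) (wlast u).

(** By [hN] all product indices of a normal word are zero, so the letters and the final exponent
    determine it. *)
Lemma normal_word_eq u v : normal_word N u -> normal_word N v ->
  letters u = letters v -> wexp u = wexp v -> u = v.
Proof.
have pre0 (p : seq (B * mi n)) : normal_left N p -> p = [seq (b, m0) | b <- map fst p].
  elim: p => [|[b m] p IH] //= /andP [/=]; rewrite hN => /eqP -> /IH {1}->.
  by [].
case: u v => [p [b e]] [p' [b' e']] /pre0 /= pE /pre0 /= pE'.
by rewrite /letters /wlast /wexp /= => /rcons_inj [epp' -> ->]; rewrite pE epp' -pE'.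
Qed.

(** Each generator is sent to the constant current on its path matrix for the letters of [w]. A
    normal word then becomes, up to a nonzero scalar, a product of these matrices placed at its
    exponent. *)
Lemma nword_separated w : normal_word N w -> exists psi : C -> k,
  [/\ linear (psi : C -> k^o), psi (nword gen w) != 0
    & forall u, normal_word N u -> u != w -> psi (nword gen u) = 0].
Proof.
move=> Nw; pose M := pathmx k (letters w).
have [_ _ _ /(_ (cur n 'M[k]_((size (letters w)).+1)) (fun b => cdelta m0 (M b)))] := hC.
case=> [||phi [phi_hom phi_gen _]]; first exact: cur_assoc.
  by move=> a b m; rewrite hN; exact: curM_delta0.
have [phi_lin _ phiM] := phi_hom.
have phi_word u : normal_word N u -> exists2 c : k, c != 0 &
    phi (nword gen u) = cdelta (wexp u) (c *: \prod_(b <- letters u) M b).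
  move=> Nu; have [c c_nz Hc] := @Dpow_delta k n 'M[k]_((size (letters w)).+1) char0 (wexp u).
  exists c => //; rewrite /nword /letters.
  move: Nu; rewrite /normal_word; elim: (wpre u) => [_|[b m] p IH] /=.
    by rewrite (Dpow_hom _ _ phi_hom) phi_gen Hc big_seq1.
  move=> /andP [/=]; rewrite hN => /eqP -> /IH.
  by rewrite phiM phi_gen => ->; rewrite curM_delta big_cons scalerAr.
(* The coefficient at [wexp w] tests the exponent; the corner entry tests whether the letters trace
   the whole path of [w]. *)
exists (fun x => (phi x : current _ _) (wexp w) ord0 ord_max); split.
- by move=> c x y; rewrite phi_lin !currentE !mxE.
- have [c c_nz ->] := phi_word w Nw.
  by rewrite cdeltaE eqxx mxE prod_pathmx drop0 take_size !eqxx mulr1.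
move=> u Nu uw; have [c c_nz ->] := phi_word u Nu.
rewrite cdeltaE; case: eqP => [ew|_]; last by rewrite mxE.
rewrite mxE prod_pathmx drop0 /= add0n; case: eqP => [sz|_]; last by rewrite mulr0.
case: eqP => [eq_uw|_]; last by rewrite mulr0.
case/eqP: uw; apply: normal_word_eq => //.
by rewrite eq_uw -sz take_size.
Qed.

(** The separating functional of a normal word reads off its coefficient from [f]; at other words
    both families vanish by definition. *)
Lemma expansion_uniq f c1 c2 :
  expansion N gen f c1 -> expansion N gen f c2 -> c1 = c2.
Proof.
move=> H1 H2; apply/fsfunP => w.
have [Nw|Nw] := boolP (normal_word N w); last first.
  have outside c : expansion N gen f c -> c w = 0.
    by case=> Nc _; apply/eqP; rewrite -memNfinsupp; apply: contra Nw => /Nc.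
  by rewrite !outside.
have [psi [psi_lin psi_w psi_u]] := nword_separated Nw.
have coefE c : expansion N gen f c -> psi f = c w * psi (nword gen w).
  case=> Nc ->; rewrite (lin_sum psi_lin).
  have [wc|wc] := boolP (w \in finsupp c); last first.
    rewrite fsfun_dflt // mul0r big_seq big1 // => u uc.
    rewrite (linZ psi_lin) psi_u ?scaler0 //; first exact: Nc.
    by apply: contra wc => /eqP <-.
  rewrite (big_fsetD1 w) //= big_seq big1 ?addr0 => [|u].
    by rewrite (linZ psi_lin).
  rewrite !inE => /andP [uw uc].
  by rewrite (linZ psi_lin) psi_u ?scaler0 //; exact: Nc.
by apply/(mulIf psi_w); rewrite -!coefE.
Qed.

End NormalWordsIndependent.

(** * Polynomials and S-words *)

Section FiniteCombinations.
Variables (k : fieldType) (T : choiceType).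

(** Collects repeated terms, so that a combination can be written as a plain list without checking
    that its entries are distinct. *)
Lemma fsfun_of_seq (r : seq (k * T)) : exists c : {fsfun T -> k with 0},
  [/\ forall u, c u = \sum_(x <- r | x.2 == u) x.1,
      forall u, u \in finsupp c -> u \in map snd r
    & forall (V : lmodType k) (v : T -> V),
        \sum_(u <- finsupp c) c u *: v u = \sum_(x <- r) x.1 *: v x.2].
Proof.
pose X : {fset T} := [fset u in map snd r]%fset.
pose c : {fsfun T -> k with 0} := [fsfun u in X => \sum_(x <- r | x.2 == u) x.1 | 0].
have cE u : c u = \sum_(x <- r | x.2 == u) x.1.
  rewrite fsfunE; case: ifPn => //; rewrite !inE => ur; rewrite big_seq_cond big1 //.
  by move=> x /andP [xr /eqP xu]; rewrite -xu map_f in ur.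
have c_supp u : u \in finsupp c -> u \in map snd r.
  by move=> /(fsubsetP (finsupp_sub _ _ _)); rewrite !inE.
exists c; split=> // V v.
rewrite (@big_fset_incl _ _ _ _ _ X) => [|| u _ /fsfun_dflt ->]; last 2 first.
- exact: finsupp_sub.
- by rewrite scale0r.
under eq_bigr do rewrite cE scaler_suml.
rewrite (exchange_big_dep predT) //= !big_seq; apply: eq_bigr => x xr.
rewrite big_mkcond (big_fsetD1 x.2) /=; last by rewrite !inE map_f.
rewrite eqxx big_seq big1 ?addr0 // => u; rewrite !inE => /andP [/negbTE ux _].
by rewrite eq_sym ux.
Qed.

End FiniteCombinations.

(** * The weight order on words *)

Section WordOrder.
Variables (d : Order.disp_t) (B : orderType d) (n : nat).
Implicit Types (u v : word B n).

Lemma wt_inj : injective (@wt d B n).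
Proof.
move=> [p [b e]] [p' [b' e']]; rewrite /wt /wlen /wpre /wlast /wexp /=.
by case=> _ /rcons_inj [-> -> ->].
Qed.

Lemma wle_anti u v : wle u v -> wle v u -> u = v.
Proof. by move=> uv vu; apply/wt_inj/le_anti/andP. Qed.

Lemma wltW u v : wlt u v -> wle u v.
Proof. exact: ltW. Qed.

Lemma wlt_len u v : (wlen u < wlen v)%N -> wlt u v.
Proof.
move=> lt_uv; rewrite /wlt Order.ProdLexiOrder.ltEprodlexi /=.
by rewrite !leEnat ltnW //= leqNgt lt_uv.
Qed.

Lemma wlt_head x y m m' (p p' : seq (B * mi n)) l l' :
  (x < y)%O -> size p = size p' -> wlt ((x, m) :: p, l) ((y, m') :: p', l').
Proof.
move=> xy pp'; rewrite /wlt /wt Order.ProdLexiOrder.ltEprodlexi /=.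
rewrite /wlen /wpre /= pp' lexx /= Order.SeqLexiOrder.ltxi_cons.
by rewrite !Order.ProdLexiOrder.leEprodlexi /= ltW //= (lt_geF xy).
Qed.

Lemma wlt_cons x (p p' : seq (B * mi n)) l l' :
  size p = size p' -> wlt (p, l) (p', l') -> wlt (x :: p, l) (x :: p', l').
Proof.
move=> pp'; rewrite /wlt /wt !Order.ProdLexiOrder.ltEprodlexi /=.
by rewrite /wlen /wpre /= pp' !lexx /= Order.SeqLexiOrder.eqhead_ltxiE.
Qed.

End WordOrder.

(** * D-free polynomials, combinations of S-words, and products of generators *)

Section ConformalPolynomials.
Variables (k : fieldType) (n : nat) (d : Order.disp_t) (B : orderType d).
Variables (N : mi n) (C : nconf k n) (gen : B -> C).
Implicit Types (x y f : C) (u v w : word B n).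

Lemma Dpow0 x : Dpow m0 x = x.
Proof. by rewrite /Dpow; elim: (enum 'I_n) => [|j r IH] //=; rewrite IH tnth_m0. Qed.

Lemma prod0l m y : cprod (0 : C) m y = 0.
Proof. exact: (lin0 (cprod_linearl m y)). Qed.

Lemma prod0r x m : cprod x m (0 : C) = 0.
Proof. exact: (lin0 (cprod_linearr x m)). Qed.

Lemma prodBl x y m z : cprod (x - y : C) m z = cprod x m z - cprod y m z.
Proof. exact: (linB (cprod_linearl m z)). Qed.

Lemma prodBr x m y z : cprod (x : C) m (y - z) = cprod x m y - cprod x m z.
Proof. exact: (linB (cprod_linearr x m)). Qed.

Lemma expansion_of_seq (r : seq (k * word B n)) :
  all (normal_word N) (map snd r) -> exists c,
  [/\ expansion N gen (\sum_(x <- r) x.1 *: nword gen x.2) c,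
      forall u, c u = \sum_(x <- r | x.2 == u) x.1
    & forall u, u \in finsupp c -> u \in map snd r].
Proof.
move=> /allP Nr; have [c [cE c_supp c_sum]] := fsfun_of_seq r.
by exists c; split=> //; split=> [u /c_supp /Nr //|]; rewrite c_sum.
Qed.

Lemma Dfree_lin a x y : Dfree N gen x -> Dfree N gen y -> Dfree N gen (a *: x + y).
Proof.
move=> [c [Nc ->] Dc] [c' [Nc' ->] Dc'].
pose r := [seq (a * c u, u) | u <- finsupp c] ++ [seq (c' u, u) | u <- finsupp c'].
have rE : map snd r = finsupp c ++ finsupp c'.
  by rewrite map_cat -!map_comp !map_id.
have [|e [eE _ e_supp]] := @expansion_of_seq r.
  by rewrite rE all_cat; apply/andP; split; apply/allP => u; [exact: Nc | exact: Nc'].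
exists e; last first.
  by move=> u /e_supp; rewrite rE mem_cat => /orP [/Dc|/Dc'].
move: eE; rewrite big_cat !big_map /= scaler_sumr.
by under eq_bigr do rewrite -scalerA.
Qed.

Lemma Dfree_nword u : normal_word N u -> wDfree u -> Dfree N gen (nword gen u).
Proof.
move=> Nu Du; have [|c [cE _ c_supp]] := @expansion_of_seq [:: (1, u)].
  by rewrite /= Nu.
exists c; first by move: cE; rewrite big_seq1 scale1r.
by move=> v /c_supp; rewrite inE => /eqP ->.
Qed.

Lemma Dfree0 : Dfree N gen 0.
Proof.
have [|c [cE _ c_supp]] := @expansion_of_seq [::]; first by [].
by exists c => [|v /c_supp //]; move: cE; rewrite big_nil.
Qed.

Lemma Dfree_map (phi : C -> C) x : linear phi ->
  (forall u, normal_word N u -> wDfree u -> Dfree N gen (phi (nword gen u))) ->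
  Dfree N gen x -> Dfree N gen (phi x).
Proof.
move=> phi_lin phi_w [c [Nc ->] Dc]; rewrite (lin_sum phi_lin) big_seq.
elim/big_rec: _ => [|u y uc Dy]; first exact: Dfree0.
rewrite (linZ phi_lin); apply: Dfree_lin => //.
by apply: phi_w; [exact: Nc | exact: Dc].
Qed.

Lemma Dfree_mull b m x : mlt m N ->
  Dfree N gen x -> Dfree N gen (cprod (gen b) m x).
Proof.
move=> mN; apply: Dfree_map; first exact: cprod_linearr.
move=> u Nu Du; apply: (@Dfree_nword ((b, m) :: wpre u, u.2)) => //.
by rewrite /normal_word /= mN.
Qed.

Section Combinations.
Variables (S : set C) (P : word B n -> Prop) (df : Prop).

Lemma Scomb0 : Scomb N gen S P df 0.
Proof. by exists [::]; rewrite big_nil. Qed.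

Lemma Scomb_lin a x y :
  Scomb N gen S P df x -> Scomb N gen S P df y -> Scomb N gen S P df (a *: x + y).
Proof.
move=> [r [Hr ->]] [r' [Hr' ->]].
exists ([seq (a * cx.1, cx.2) | cx <- r] ++ r'); split.
  move=> cx; rewrite mem_cat => /orP [/mapP [cx' /Hr h ->] //|]; exact: Hr'.
rewrite big_cat big_map /= scaler_sumr.
by under [in RHS]eq_bigr do rewrite -scalerA.
Qed.

Lemma ScombZ a x : Scomb N gen S P df x -> Scomb N gen S P df (a *: x).
Proof. by move=> Hx; rewrite -[_ *: _]addr0; apply: Scomb_lin Hx Scomb0. Qed.

Lemma ScombD x y :
  Scomb N gen S P df x -> Scomb N gen S P df y -> Scomb N gen S P df (x + y).
Proof. by rewrite -{2}[x]scale1r; exact: Scomb_lin. Qed.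

Lemma ScombN x : Scomb N gen S P df x -> Scomb N gen S P df (- x).
Proof. by rewrite -scaleN1r; exact: ScombZ. Qed.

Lemma ScombB x y :
  Scomb N gen S P df x -> Scomb N gen S P df y -> Scomb N gen S P df (x - y).
Proof. by move=> Hx Hy; apply: ScombD Hx (ScombN Hy). Qed.

Lemma Scomb_Sword x w : Sword N gen S x w -> P w -> (df -> Dfree N gen x) ->
  Scomb N gen S P df x.
Proof.
move=> Sx Pw Dx; exists [:: (1, x)]; rewrite big_seq1 scale1r; split=> // cx.
by rewrite inE => /eqP ->; exists w.
Qed.

End Combinations.

Hypothesis C_assoc : associative_conf C.

Lemma prod_assoc m m' x y z :
  cprod (cprod x m y) m' z =
  bsum m (fun s => cprod (x : C) (msub m s) (cprod y (madd m' s) z)).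
Proof. by rewrite C_assoc -fsbig_bcoef. Qed.

Lemma prod0_assoc m x y z :
  cprod (cprod (x : C) m0 y) m z = cprod x m0 (cprod y m z).
Proof.
rewrite prod_assoc bsum_m0 addm0; congr (cprod x _ _).
by apply: mi_eq => i; rewrite !tnthE.
Qed.

Hypotheses (hN : forall m, mlt m N = (m == m0)) (gen_local : local_on N gen).

(** Locality gives [(a<m>b)<0>c = 0]. In its expansion by associativity the terms with [s] nonzero
    contain [b<s>c = 0], which leaves only [a<m>(b<0>c)]. *)
Lemma gen_prod_gen0 m a b c : m != m0 ->
  cprod (gen a) m (cprod (gen b) m0 (gen c)) = 0.
Proof.
move=> nz_m; have nN t : t != m0 -> ~~ mlt t N by rewrite hN.
have := prod_assoc m m0 (gen a) (gen b) (gen c).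
rewrite gen_local ?nN // prod0l /bsum (big_fsetD1 m0) /=; last first.
  by rewrite in_mbox; apply/mleP => i; rewrite tnthE.
rewrite big_seq big1 ?addr0 => [|s]; last first.
  rewrite !inE => /andP [nz_s _].
  by rewrite (gen_local b c) ?prod0r ?scaler0 // add0m nN.
rewrite /bcoef mdeg0 mbinm0 mulr1 scale1r addm0 => ->.
by congr (cprod _ _ _); apply: mi_eq => i; rewrite !tnthE subn0.
Qed.

(** All products in a normal word are [<0>], so associativity moves the new factor to the last
    letter. As that letter carries no derivative, a D-free normal word results. *)
Lemma Dfree_mulr x b : Dfree N gen x -> Dfree N gen (cprod x m0 (gen b)).
Proof.
apply: (@Dfree_map (fun x => cprod x m0 (gen b))); first exact: cprod_linearl.
move=> [p [c e]]; rewrite /normal_word /nword /wDfree /= /wexp /wpre /wlast /=.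
move=> Np /eqP ->; rewrite Dpow0; elim: p Np => [_|[c' m] p IH] /=.
  apply: Dfree_mull; first by rewrite hN.
  rewrite -[gen b]Dpow0; apply: (@Dfree_nword ([::], (b, m0))) => //.
  by rewrite /wDfree /=.
move=> /andP [/=]; rewrite {1}hN => /eqP -> /IH.
by rewrite prod0_assoc; apply: Dfree_mull; rewrite hN.
Qed.

Lemma curly_gen a b :
  curly (gen a) m0 (gen b) = cprod (gen a) m0 (gen b).
Proof.
rewrite /curly -(@fsbig_widen _ _ _ _ [set m0]%classic) //; last first.
  move=> s [_ /= nz_s]; rewrite add0m gen_local; last by rewrite hN; apply/eqP.
  rewrite (_ : Dpow s 0 = 0) ?scaler0 // /Dpow.
  elim: (enum 'I_n) => [|j r IH] //=; rewrite IH; elim: (tnth s j) => [|q IHq] //=.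
  by rewrite IHq; exact: (lin0 (cD_linear j)).
rewrite fsbig_set1 Dpow0 addm0 mdeg0 /mfact big1 ?invr1 ?mulr1 ?scale1r //.
by move=> i _; rewrite tnth_m0.
Qed.

End ConformalPolynomials.

(** * The enveloping relations *)

(* Cancels the leading term of a sum against its opposite, in a goal of the form
   [x + (y + (... + 0)) = 0]. *)
Ltac cancel_head :=
  lazymatch goal with
  | |- - ?x + _ = 0 =>
      repeat match goal with |- context [?z + (x + ?t)] =>
        lazymatch z with - x => fail | _ => rewrite (addrCA z x t) end end;
      rewrite (addKr x)
  | |- ?x + _ = 0 =>
      repeat match goal with |- context [?z + (- x + ?t)] =>
        tryif constr_eq z x then fail else rewrite (addrCA z (- x) t) end;
      rewrite (addNKr x)
  end.

Ltac cancel_sum :=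
  apply/subr0_eq; rewrite -[LHS]addr0 !(opprD, opprK, oppr0) -!addrA;
  repeat cancel_head; rewrite ?addr0; reflexivity.

Section UniversalEnveloping.
Variables (k : fieldType) (d : Order.disp_t) (I : orderType d).
Variables (g : lmodType k) (br : g -> g -> g) (a : I -> g).
Variables (C : nconf k 2) (gen : I -> C).
Local Notation N := [tuple 1%N; 1%N].
Hypotheses (char0 : [pchar k] =i pred0) (hbr : lie_bracket br).
Hypotheses (ha : linear_basis a) (hC : free_assoc_conf N gen).

Let C_assoc : associative_conf C. Proof. by case: hC. Qed.
Let gen_local : local_on N gen. Proof. by case: hC. Qed.

Lemma mlt11 (m : mi 2) : mlt m N = (m == m0).
Proof.
have N1 i : tnth N i = 1%N by case: i => [[|[|[]]]].
apply/forallP/eqP => [lt_m|-> i]; last by rewrite N1 tnth_m0.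
by apply: mi_eq => i; have := lt_m i; rewrite N1 tnth_m0; case: (tnth m i).
Qed.

Lemma tuple00 : [tuple 0%N; 0%N] = m0 :> mi 2.
Proof. by apply: mi_eq => i; rewrite tnth_m0; case: i => [[|[|[]]]]. Qed.

Lemma lie_antisym x y : br x y = - br y x.
Proof.
case: hbr => brl brr br0 _; apply/eqP; rewrite -addr_eq0.
have := br0 (x + y).
by rewrite (linD (brl _)) !(linD (brr _)) !br0 add0r addr0 => ->.
Qed.

(** The linear extension of [a i |-> gen i]; uniqueness of coordinates makes it linear. It lets the
    relations and the Jacobi identity be used in [C] without coordinates. *)
Lemma exists_embedding : exists iota : g -> C,
  linear iota /\ forall i, iota (a i) = gen i.
Proof.
have /choice [co coP] x : exists c : {fsfun I -> k with 0},
    x = \sum_(l <- finsupp c) c l *: a l.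
  by have [c []] := ha x; exists c.
pose iota x := \sum_(l <- finsupp (co x)) co x l *: gen l.
have iotaE (c : {fsfun I -> k with 0}) :
    iota (\sum_(l <- finsupp c) c l *: a l) = \sum_(l <- finsupp c) c l *: gen l.
  have [c' [_ c'_uniq]] := ha (\sum_(l <- finsupp c) c l *: a l).
  by rewrite /iota -(c'_uniq _ (coP _)) -(c'_uniq c).
have iota_seq (r : seq (k * I)) :
    iota (\sum_(x <- r) x.1 *: a x.2) = \sum_(x <- r) x.1 *: gen x.2.
  by have [c [_ _ c_sum]] := fsfun_of_seq r; rewrite -!c_sum iotaE.
exists iota; split=> [b x y|i]; last first.
  by have := iota_seq [:: (1, i)]; rewrite !big_seq1 !scale1r.
(* An unreduced list of coordinates of [b x + y]; repeated indices are harmless by [iota_seq]. *)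
pose r := [seq (b * co x l, l) | l <- finsupp (co x)] ++ [seq (co y l, l) | l <- finsupp (co y)].
have := iota_seq r; rewrite !big_cat !big_map /=.
under eq_bigr do rewrite -scalerA.
under [X in _ = X + _]eq_bigr do rewrite -scalerA.
by rewrite -!scaler_sumr -!coP.
Qed.

Variable iota : g -> C.
Hypothesis iota_linear : linear iota.
Hypothesis iota_a : forall i, iota (a i) = gen i.

Local Notation "x ∘ y" := (cprod x m0 y) (at level 40, left associativity).
Local Notation S := (ueaS br a gen).

Definition commutator (x y : C) : C := x ∘ y - y ∘ x.
Definition lie_rel i j : C := commutator (gen i) (gen j) - iota (br (a i) (a j)).

Definition w1 l : word I 2 := ([::], (l, m0)).
Definition w2 i j : word I 2 := ([:: (i, m0)], (j, m0)).
Definition w3 i j l : word I 2 := ([:: (i, m0); (j, m0)], (l, m0)).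

Lemma nword_w1 i : nword gen (w1 i) = gen i. Proof. exact: Dpow0. Qed.
Lemma nword_w2 i j : nword gen (w2 i j) = gen i ∘ gen j.
Proof. by rewrite /nword /= Dpow0. Qed.

Lemma iota_sum x : exists2 c : {fsfun I -> k with 0},
  x = \sum_(l <- finsupp c) c l *: a l & iota x = \sum_(l <- finsupp c) c l *: gen l.
Proof.
have [c [cE _]] := ha x; exists c; first by [].
rewrite {1}cE (lin_sum iota_linear); apply: eq_bigr => l _.
by rewrite (linZ iota_linear) iota_a.
Qed.

Lemma ueaSP f : S f <-> exists i j, (j < i)%O /\ f = lie_rel i j.
Proof.
have relE i j : lie_rel i j =
    gen i ∘ gen j - curly (gen j) m0 (gen i) - iota (br (a i) (a j)).
  by rewrite (curly_gen mlt11 gen_local).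
split=> [[i [j [c [ji brE ->]]]]|[i [j [ji ->]]]].
  exists i, j; split=> //; rewrite relE tuple00 brE; congr (_ - _).
  rewrite (lin_sum iota_linear); apply: eq_bigr => l _.
  by rewrite (linZ iota_linear) iota_a.
have [c brE iotaE] := iota_sum (br (a i) (a j)).
by exists i, j, c; split=> //; rewrite relE tuple00 iotaE.
Qed.

Lemma lie_rel_expansion i j : (j < i)%O -> exists c,
  [/\ expansion N gen (lie_rel i j) c, c (w2 i j) = 1
    & forall u, u \in finsupp c ->
        [\/ u = w2 i j, u = w2 j i | exists l, u = w1 l]].
Proof.
move=> ji; have [c _ iotaE] := iota_sum (br (a i) (a j)).
pose r := (1, w2 i j) :: (-1, w2 j i) :: [seq (- c l, w1 l) | l <- finsupp c].
have [|e [eE eW e_supp]] := @expansion_of_seq k 2 d I N C gen r.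
  rewrite /= /normal_word /= mlt11 eqxx /=; apply/allP => _ /mapP [x /mapP [l _ ->] ->].
  by [].
exists e; split.
- move: eE; rewrite !big_cons /= big_map !nword_w2 scale1r scaleN1r addrA.
  rewrite /lie_rel iotaE -sumrN.
  by under eq_bigr do rewrite nword_w1 scaleNr.
- rewrite eW !big_cons /= eqxx ifF; last first.
    by apply/eqP; case=> ij _; move: ji; rewrite ij ltxx.
  by rewrite big_map big_pred0 ?addr0.
move=> u /e_supp; rewrite !inE => /or3P [/eqP ->|/eqP ->|/mapP [x /mapP [l _ ->] ->]].
- by constructor 1.
- by constructor 2.
- by constructor 3; exists l.
Qed.

(** Since [i > j], the word of [x_j x_i] loses at its first letter, and the words coming from the
    bracket are shorter. *)
Lemma lie_rel_leading i j : (j < i)%O -> leading_term N gen (lie_rel i j) (w2 i j) 1.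
Proof.
move=> ji; have [c [cE c1 c_supp]] := lie_rel_expansion ji.
exists c => //; split=> //.
  by apply/negPn; rewrite memNfinsupp c1 oner_neq0.
move=> v /c_supp [->|->|[l ->]]; first exact: lexx.
  by apply/wltW/wlt_head.
exact/wltW/wlt_len.
Qed.

Lemma lie_rel_Dfree i j : (j < i)%O -> Dfree N gen (lie_rel i j).
Proof.
move=> ji; have [c [cE _ c_supp]] := lie_rel_expansion ji.
by exists c => // v /c_supp [->|->|[l ->]]; exact: eqxx.
Qed.

(** Compositions and S-words accept any leading word of a polynomial; uniqueness of expansions pins
    it down. *)
Lemma lie_rel_leading_uniq i j w : (j < i)%O -> leading N gen (lie_rel i j) w -> w = w2 i j.
Proof.
move=> ji [al [c cE [wc _ c_max]]]; have [c' cE' [wc' _ c_max']] := lie_rel_leading ji.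
have cc' := expansion_uniq char0 hC mlt11 cE cE'; rewrite -cc' in wc' c_max'.
by apply: wle_anti; [exact: c_max' | exact: c_max].
Qed.

Lemma commutatorDl x y z : commutator (x + y) z = commutator x z + commutator y z.
Proof.
rewrite /commutator (linD (cprod_linearl _ _)) (linD (cprod_linearr _ _)).
by rewrite opprD addrACA.
Qed.

Lemma commutatorNl x y : commutator (- x) y = - commutator x y.
Proof.
by rewrite /commutator (linN (cprod_linearl _ _)) (linN (cprod_linearr _ _)) opprD.
Qed.

Lemma commutator_jacobi x y z :
  commutator (commutator x y) z + commutator (commutator y z) x
    + commutator (commutator z x) y = 0.
Proof.
rewrite /commutator !prodBl !prodBr !(prod0_assoc C_assoc).
cancel_sum.
Qed.

(** * S-words of length two and three *)

Section Reduction.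
Variables (P : word I 2 -> Prop) (df : Prop).
Local Notation combination := (Scomb N gen S P df).

Lemma lie_rel_comb i j : (j < i)%O -> P (w2 i j) -> combination (lie_rel i j).
Proof.
move=> ji Pw; apply: (Scomb_Sword (w := w2 i j)) => // [|_]; last exact: lie_rel_Dfree.
apply: (@Sword_first _ _ _ _ _ _ _ _ [::] (lie_rel i j) (w2 i j) None) => //.
- by apply/ueaSP; exists i, j.
- exact: lie_rel_Dfree.
- by exists 1; exact: lie_rel_leading.
Qed.

Lemma lie_rel_mull_comb l i j : (j < i)%O -> P (w3 l i j) ->
  combination (gen l ∘ lie_rel i j).
Proof.
move=> ji Pw; apply: (Scomb_Sword (w := w3 l i j)) => // [|_]; last first.
  by apply: Dfree_mull; [by rewrite mlt11 | exact: lie_rel_Dfree].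
apply: (@Sword_first _ _ _ _ _ _ _ _ [:: (l, m0)] (lie_rel i j) (w2 i j) None) => //.
- by apply/ueaSP; exists i, j.
- exact: lie_rel_Dfree.
- by exists 1; exact: lie_rel_leading.
- by rewrite /normal_word /= mlt11 eqxx.
Qed.

Lemma lie_rel_mulr_comb l i j : (j < i)%O -> P (w3 i j l) ->
  combination (lie_rel i j ∘ gen l).
Proof.
move=> ji Pw; apply: (Scomb_Sword (w := w3 i j l)) => // [|_]; last first.
  by apply: (Dfree_mulr C_assoc mlt11); exact: lie_rel_Dfree.
rewrite -nword_w1.
apply: (@Sword_first _ _ _ _ _ _ _ _ [::] (lie_rel i j) (w2 i j) (Some (m0, w1 l))) => //.
- by apply/ueaSP; exists i, j.
- exact: lie_rel_Dfree.
- by exists 1; exact: lie_rel_leading.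
- by rewrite /normal_word /= mlt11 eqxx.
Qed.

(** Expanding [y] in the basis gives a combination of the [lie_rel l i]. Each of these is a
    relation, the opposite of one, or zero, according to the order of [l] and [i]. *)
Lemma commutator_iota_comb y i : (forall p q, P (w2 p q)) ->
  combination (commutator (iota y) (gen i) - iota (br y (a i))).
Proof.
move=> Pw; have [c yE iotaE] := iota_sum y.
have [brl _ br0 _] := hbr.
have -> : commutator (iota y) (gen i) - iota (br y (a i)) =
    \sum_(l <- finsupp c) c l *: lie_rel l i.
  rewrite iotaE {1}yE (lin_sum (brl _)) (lin_sum iota_linear) /commutator.
  rewrite (lin_sum (cprod_linearl m0 (gen i))) (lin_sum (cprod_linearr (gen i) m0)).
  rewrite -!sumrB; apply: eq_bigr => l _.
  rewrite (linZ (brl _)) (linZ iota_linear) (linZ (cprod_linearl m0 (gen i))).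
  by rewrite (linZ (cprod_linearr (gen i) m0)) -!scalerBr.
elim/big_rec: _ => [|l x _ Hx]; first exact: Scomb0.
apply: Scomb_lin Hx; case: (ltgtP i l) => [il|li|->].
- exact: lie_rel_comb.
- rewrite (_ : lie_rel l i = - lie_rel i l); first by apply/ScombN/lie_rel_comb.
  by rewrite /lie_rel /commutator lie_antisym (linN iota_linear) !opprB !opprK addrC.
- by rewrite /lie_rel /commutator br0 (lin0 iota_linear) !subrr; exact: Scomb0.
Qed.

End Reduction.

(** The Jacobi identity for commutators in [C] is compared with that of the Lie algebra, after
    writing each commutator of generators as a relation plus the image of a bracket. *)
Lemma overlap_comb i j l (df : Prop) : (j < i)%O -> (l < j)%O ->
  Scomb N gen S (fun v => wlt v (w3 i j l)) df
    (lie_rel i j ∘ gen l - gen i ∘ lie_rel j l).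
Proof.
move=> ji lj; have li := lt_trans lj ji; have [_ _ _ jac] := hbr.
pose D y p := commutator (iota y) (gen p) - iota (br y (a p)).
have commE p q : commutator (gen p) (gen q) = lie_rel p q + iota (br (a p) (a q)).
  by rewrite /lie_rel subrK.
have jacD : iota (br (br (a i) (a j)) (a l)) + iota (br (br (a j) (a l)) (a i))
    + iota (br (br (a l) (a i)) (a j)) = 0.
  rewrite -!(linD iota_linear) (_ : _ + _ = 0) ?(lin0 iota_linear) //.
  rewrite (lie_antisym (br _ _) (a l)) (lie_antisym (br _ _) (a i)).
  rewrite (lie_antisym (br _ _) (a j)).
  by rewrite -!opprD jac oppr0.
have relN : lie_rel l i = - lie_rel i l.
  by rewrite /lie_rel /commutator lie_antisym (linN iota_linear) !opprB !opprK addrC.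
have jacC := commutator_jacobi (gen i) (gen j) (gen l).
rewrite !commE (commutatorDl (lie_rel i j)) (commutatorDl (lie_rel j l))
  (commutatorDl (lie_rel l i)) relN commutatorNl in jacC.
have -> : lie_rel i j ∘ gen l - gen i ∘ lie_rel j l =
    gen l ∘ lie_rel i j - lie_rel j l ∘ gen i + (lie_rel i l ∘ gen j - gen j ∘ lie_rel i l)
    - (D (br (a i) (a j)) l + D (br (a j) (a l)) i + D (br (a l) (a i)) j).
  (* Both Jacobi identities are inserted as zeros; the two S-words with leading word [x_i x_j x_l]
     then cancel. *)
  rewrite -[LHS]subr0 -[X in _ - X]jacC -[LHS]addr0 -[X in _ + X = _]jacD /D /commutator.
  cancel_sum.
have wlt2 p q : wlt (w2 p q) (w3 i j l) by exact: wlt_len.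
(* The cubic leading words are [lij], [jli], [ilj] and [jil]: only [ilj] shares the first letter
   [i], and it is smaller at the second. The [D] terms have words of length two. *)
apply: ScombB; first apply: ScombD; try apply: ScombB.
- by apply: lie_rel_mull_comb => //; apply: wlt_head.
- by apply: lie_rel_mulr_comb => //; apply: wlt_head.
- by apply: lie_rel_mulr_comb => //; apply: wlt_cons => //; apply: wlt_head.
- by apply: lie_rel_mull_comb => //; apply: wlt_head.
by apply: ScombD; [apply: ScombD|]; exact: commutator_iota_comb.
Qed.

(** All leading words have length two. Both kinds of inclusion therefore compare a relation with
    itself and give zero, and an intersection shares exactly one letter. *)
Lemma composition_comb i j i' j' w h (df : Prop) : (j < i)%O -> (j' < i')%O ->
  composition N gen (lie_rel i j) (lie_rel i' j') w h ->
  Scomb N gen S (fun v => wlt v w) df h.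
Proof.
move=> ji ji'; case=> {w h}.
- move=> fb gb p q /(lie_rel_leading_uniq ji) -> /(lie_rel_leading_uniq ji') -> _ _ _.
  case: q => [[m v]|]; case: p => [|x p] //=.
  + by move=> [_ /(congr1 size)]; rewrite size_cat /= addnS.
  + by case=> -> ->; rewrite subrr; exact: Scomb0.
  + by move=> [_ /(congr1 size)]; rewrite size_cat /= addnS.
- move=> fb gb p J e w /(lie_rel_leading_uniq ji) -> /(lie_rel_leading_uniq ji') -> _ ->.
  case: p => [|x p]; last by move=> [_ /(congr1 size)]; rewrite size_cat /= addnS.
  rewrite /wD /wcatl /wexp !add0m => eq_w.
  (* Equal words force equal exponents on both sides, so the same derivative of the same relation is
     subtracted from itself. *)
  have [-> -> ->] : [/\ i = i', j = j' & mrestr J e = mrestr (~: J) e].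
    by case: eq_w => -> ej eJ; split=> //; exact: val_inj.
  by rewrite subrr; exact: Scomb0.
move=> fb gb [p [i0 e]] m [q [l e']] m' w.
move=> /(lie_rel_leading_uniq ji) -> /(lie_rel_leading_uniq ji') -> _ _ _ _ _ _ ->.
(* The length of [w] is below 4, so [u] and [v] have one letter each and [w] is [x_i x_j x_l], with
   [x_j] shared. *)
rewrite /wcat /wlast /wexp /=; case: p => [|x p] /=; last first.
  move=> /(congr1 (fun u => size u.1)); rewrite /wlen /= size_cat /= => eq_sz lt_sz.
  by case: q eq_sz lt_sz => [|y q] /=; rewrite ?addnS.
move=> [<- <- eq_j -> -> -> ->] _; rewrite -eq_j in ji' *.
by rewrite nword_w1; exact: overlap_comb.
Qed.

Lemma uea_GS : GS_basis N gen S.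
Proof.
split.
- by move=> f /ueaSP [i [j [ji ->]]]; exists (w2 i j); exact: lie_rel_leading.
- move=> f f' w h /ueaSP [i [j [ji ->]]] /ueaSP [i' [j' [ji' ->]]] comp_h.
  exact: composition_comb comp_h.
(* A left multiplication composition is zero: [gen_prod_gen0] kills the quadratic terms and locality
   the linear ones. *)
- move=> b m f /ueaSP [i [j [ji ->]]]; rewrite mlt11 => nz_m; left.
  rewrite /lie_rel /commutator !prodBr !(gen_prod_gen0 C_assoc mlt11 gen_local) //.
  have [c _ ->] := iota_sum (br (a i) (a j)).
  rewrite subrr sub0r (lin_sum (cprod_linearr _ _)) big1 ?oppr0 // => l _.
  by rewrite (linZ (cprod_linearr _ _)) gen_local ?scaler0 // mlt11.
(* There is no right multiplication composition, since every relation is D-free. *)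
- move=> b m f /ueaSP [i [j [ji ->]]] []; exact: lie_rel_Dfree.
Qed.

End UniversalEnveloping.

Theorem lemma4p6 (k : fieldType) (hk : [pchar k] =i pred0)
    (d : Order.disp_t) (I : orderType d)
    (hI0 : inhabited I) (hI : well_order (<=%O : rel I))
    (g : lmodType k) (br : g -> g -> g) (hbr : lie_bracket br)
    (a : I -> g) (ha : linear_basis a)
    (C : nconf k 2) (gen : I -> C)
    (hC : free_assoc_conf [tuple 1%N; 1%N] gen) :
  GS_basis [tuple 1%N; 1%N] gen (ueaS br a gen).
Proof.
have [iota [iota_linear iota_a]] := exists_embedding gen ha.
exact: uea_GS iota_linear iota_a.
Qed.
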